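(* For every finite vocabulary $V$, every mental program $\pi$ over $V$ and all $s,t\subseteq V$: $s\xrightarrow{\pi}t$ if and only if $s\cup t'\vDash\mathsf{tr}(\pi)$.
   Context: Mental programs over a finite vocabulary $V$: $\pi::=p\leftarrow\top\mid p\leftarrow\bot\mid\beta?\mid\pi\cup\pi\mid\pi;\pi\mid\pi\cap\pi$ ($p\in V$, $\beta$ a Boolean formula over $V$). For $s,t\subseteq V$: $s\xrightarrow{p\leftarrow\top}t$ iff $t=s\cup\{p\}$; $s\xrightarrow{p\leftarrow\bot}t$ iff $t=s\setminus\{p\}$; $s\xrightarrow{\beta?}t$ iff $s=t$ and $s\vDash\beta$; $\cup$ is union, $\cap$ intersection of relations, and $s\xrightarrow{\pi_1;\pi_2}t$ iff some $u\subseteq V$ has $s\xrightarrow{\pi_1}u$ and $u\xrightarrow{\pi_2}t$. $V'=\{p'\mid p\in V\}$ and $V''=\{p''\mid p\in V\}$ are fresh copies of $V$, $t'=\{p'\mid p\in t\}$; Boolean formulas over $V\cup V'$ are evaluated at subsets of $V\cup V'$. $[A\mapsto B]\phi$ is simultaneous substitution via the evident bijection; $\exists p\,\phi:=[p\mapsto\top]\phi\lor[p\mapsto\bot]\phi$, extended to sets. The translation $\mathsf{tr}$ to Boolean formulas over $V\cup V'$: $\mathsf{tr}(p\leftarrow\top)=p'\land\bigwedge_{q\in V,q\neq p}(q\leftrightarrow q')$; $\mathsf{tr}(p\leftarrow\bot)=\neg p'\land\bigwedge_{q\in V,q\neq p}(q\leftrightarrow q')$; $\mathsf{tr}(\beta?)=\beta\land\bigwedge_{p\in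 V}(p\leftrightarrow p')$; $\mathsf{tr}(\pi_1\cup\pi_2)=\mathsf{tr}(\pi_1)\lor\mathsf{tr}(\pi_2)$; $\mathsf{tr}(\pi_1\cap\pi_2)=\mathsf{tr}(\pi_1)\land\mathsf{tr}(\pi_2)$; $\mathsf{tr}(\pi_1;\pi_2)=[V''\mapsto V'](\exists V'(\mathsf{tr}(\pi_1)\land\mathsf{tr}(\pi_2)'))$, where $\mathsf{tr}(\pi_2)'$ is obtained from $\mathsf{tr}(\pi_2)$ by simultaneously replacing each $p\in V$ by $p'$ and each $p'\in V'$ by $p''$. *)

(* Defs.v *)
From mathcomp Require Import all_boot.

Set Implicit Arguments.
Unset Strict Implicit.
Unset Printing Implicit Defensive.

Inductive form (A : Type) : Type :=
| FAtom of A
| FTop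
| FBot
| FNeg of form A
| FAnd of form A & form A
| FOr of form A & form A
| FImp of form A & form A
| FIff of form A & form A.

Arguments FTop {A}.
Arguments FBot {A}.

Fixpoint sat (A : finType) (v : {set A}) (phi : form A) : bool :=
  match phi with
  | FAtom p => p \in v
  | FTop => true
  | FBot => false
  | FNeg f => ~~ sat v f
  | FAnd f g => sat v f && sat v g
  | FOr f g => sat v f || sat v g
  | FImp f g => sat v f ==> sat v g
  | FIff f g => sat v f == sat v g
  end.

(* Simultaneous substitution; [sigma] is the identity ([FAtom]) on the atoms
   that are not replaced. *)
Fixpoint subst (A B : Type) (sigma : A -> form B) (phi : form A) : form B :=
  match phi with
  | FAtom p => sigma p
  | FTop => FTop
  | FBot => FBot
  | FNeg f => FNeg (subst sigma f)
  | FAnd f g => FAnd (subst sigma f) (subst sigma g)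
  | FOr f g => FOr (subst sigma f) (subst sigma g)
  | FImp f g => FImp (subst sigma f) (subst sigma g)
  | FIff f g => FIff (subst sigma f) (subst sigma g)
  end.

Definition rename (A B : Type) (r : A -> B) (phi : form A) : form B :=
  subst (fun p => FAtom (r p)) phi.

Definition subst1 (A : eqType) (p : A) (chi phi : form A) : form A :=
  subst (fun q => if q == p then chi else FAtom q) phi.

Definition fexists (A : eqType) (p : A) (phi : form A) : form A :=
  FOr (subst1 p FTop phi) (subst1 p FBot phi).

Definition fexists_seq (A : eqType) (ps : seq A) (phi : form A) : form A :=
  foldr (@fexists A) phi ps.

Inductive program (V : Type) : Type :=
| AssignTop of V
| AssignBot of V
| Test of form V
| Union of program V & program V
| Seq of program V & program V
| Inter of program V & program V.

Fixpoint step (V : finType) (pi : program V) (s t : {set V}) : Prop :=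
  match pi with
  | AssignTop p => t = s :|: [set p]
  | AssignBot p => t = s :\: [set p]
  | Test beta => s = t /\ sat s beta
  | Union pi1 pi2 => step pi1 s t \/ step pi2 s t
  | Seq pi1 pi2 => exists u : {set V}, step pi1 s u /\ step pi2 u t
  | Inter pi1 pi2 => step pi1 s t /\ step pi2 s t
  end.

(* V ∪ V' is the disjoint sum V + V:  p = inl p  and  p' = inr p.
   V ∪ V' ∪ V'' is (V + V) + V:  p = inl (inl p),  p' = inl (inr p)  and
   p'' = inr p,  so that inl is the inclusion of V ∪ V' into V ∪ V' ∪ V''. *)
Notation atom2 V := (V + V)%type.
Notation atom3 V := (V + V + V)%type.

Definition base (V : Type) (p : V) : atom2 V := inl p.
Definition primed (V : Type) (p : V) : atom2 V := inr p.

(* p |-> p'  and  p' |-> p'' *)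
Definition shift (V : Type) (x : atom2 V) : atom3 V :=
  match x with
  | inl p => inl (inr p)
  | inr p => inr p
  end.

(* [V'' |-> V']: identity on V ∪ V', and p'' |-> p'. *)
Definition dprime_to_prime (V : Type) (x : atom3 V) : atom2 V :=
  match x with
  | inl y => y
  | inr p => inr p
  end.

Definition same (V : Type) (p : V) : form (atom2 V) :=
  FIff (FAtom (base p)) (FAtom (primed p)).

Fixpoint tr (V : finType) (pi : program V) : form (atom2 V) :=
  match pi with
  | AssignTop p =>
      FAnd (FAtom (primed p)) (\big[@FAnd _/FTop]_(q : V | q != p) same q)
  | AssignBot p =>
      FAnd (FNeg (FAtom (primed p))) (\big[@FAnd _/FTop]_(q : V | q != p) same q)
  | Test beta =>
      FAnd (rename (@base V) beta) (\big[@FAnd _/FTop]_(p : V) same p)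
  | Union pi1 pi2 => FOr (tr pi1) (tr pi2)
  | Inter pi1 pi2 => FAnd (tr pi1) (tr pi2)
  | Seq pi1 pi2 =>
      rename (@dprime_to_prime V)
        (fexists_seq [seq inl (primed p) | p <- enum V]
          (FAnd (rename (fun x : atom2 V => inl x : atom3 V) (tr pi1))
                (rename (@shift V) (tr pi2))))
  end.

(* s ∪ t' *)
Definition pair_val (V : finType) (s t : {set V}) : {set atom2 V} :=
  [set base p | p in s] :|: [set primed p | p in t].

(* Main.v *)
Require Import Defs.
From mathcomp Require Import all_boot.

(** Satisfaction commutes with substitution once the valuation is pulled back
    along it; hence [fexists_seq ps] ranges over the valuations that differ from
    the current one on [ps] only.  For a composition, quantifying over [V'] at
    the valuation [s ∪ t' ∪ t''] amounts to choosing the intermediate state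
    [u], and the pullbacks of [s ∪ u' ∪ t''] along the two renamings are
    [s ∪ u'] and [u ∪ t']. *)

Lemma in_pair_val (V : finType) (s t : {set V}) (x : atom2 V) :
  (x \in pair_val s t) =
  match x with inl p => p \in s | inr p => p \in t end.
Proof.
rewrite /pair_val inE; case: x => p.
  by rewrite (mem_imset (f := @base V) s p inl_inj) orbC; case: imsetP => // -[].
by rewrite (mem_imset (f := @primed V) t p inr_inj); case: imsetP => // -[].
Qed.

Lemma sat_subst (A B : finType) (sigma : A -> form B) (v : {set B})
    (phi : form A) :
  sat v (subst sigma phi) = sat [set a | sat v (sigma a)] phi.
Proof.
elim: phi => [p|||f IHf|f IHf g IHg|f IHf g IHg|f IHf g IHg|f IHf g IHg] //=;
  rewrite ?inE ?IHf ?IHg //.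
Qed.

Lemma sat_rename (A B : finType) (r : A -> B) (v : {set B}) (phi : form A) :
  sat v (rename r phi) = sat (r @^-1: v) phi.
Proof. by rewrite sat_subst. Qed.

(** [FAnd] is not associative on syntax, so [sat v] first carries the iterated conjunction to one in
    [bool]. *)
Lemma sat_bigand (A I : finType) (P : pred I) (F : I -> form A) (v : {set A}) :
  sat v (\big[@FAnd _/FTop]_(i | P i) F i) = [forall (i | P i), sat v (F i)].
Proof. by rewrite (big_morph (sat v) (id1 := true) (op1 := andb)) ?big_andE. Qed.

Lemma sat_fexists (A : finType) (p : A) (phi : form A) (v : {set A}) :
  sat v (fexists p phi) = sat (p |: v) phi || sat (v :\ p) phi.
Proof.
rewrite /= /subst1 !sat_subst; congr (_ || _); congr (sat _ _);
  by apply/setP => q; rewrite !inE; case: (q == p).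
Qed.

Lemma sat_fexists_seq (A : finType) (ps : seq A) (phi : form A) (v : {set A}) :
  sat v (fexists_seq ps phi) <->
  exists2 w : {set A}, (forall x, x \notin ps -> (x \in w) = (x \in v)) & sat w phi.
Proof.
elim: ps v => [|p ps IH] v.
  split=> [sv|[w vw]]; first by exists v.
  by have -> : w = v by apply/setP => x; apply: vw.
rewrite -[fexists_seq _ _]/(fexists p (fexists_seq ps phi)) sat_fexists; split.
  by case/orP=> /IH[w vw sw]; exists w => // x;
     rewrite inE negb_or => /andP[xp /vw ->]; rewrite !inE ?xp ?(negbTE xp).
(* The disjunct is chosen by the value of [w] at [p]: the updated [v] then agrees with [w] at [p],
   so [w] also serves for the tail [ps]. *)
case=> w vw sw; apply/orP; case: (boolP (p \in w)) => pw; [left | right];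
  apply/IH; exists w => // x xps; rewrite !inE; case: (eqVneq x p) => [->|xp] //=;
  rewrite ?pw ?(negbTE pw) //; apply: vw; by rewrite inE negb_or xp.
Qed.

Lemma sat_same (V : finType) (s t : {set V}) (p : V) :
  sat (pair_val s t) (same p) = ((p \in s) == (p \in t)).
Proof. by rewrite /= !in_pair_val. Qed.

Lemma sat_tr_Seq (V : finType) (pi1 pi2 : program V) (s t : {set V}) :
  sat (pair_val s t) (tr (Seq pi1 pi2)) <->
  exists u, sat (pair_val s u) (tr pi1) /\ sat (pair_val u t) (tr pi2).
Proof.
rewrite [tr _]/= sat_rename; split.
  case/sat_fexists_seq=> w vw /= /andP[]; rewrite !sat_rename => sw1 sw2.
  (* Atoms of [V] and [V''] are not quantified, so there [w] keeps the values given by [s] and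
     [t]. *)
  have w_base p : (inl (inl p) \in w) = (p \in s).
    by rewrite vw; [rewrite inE in_pair_val | apply/mapP => -[]].
  have w_dprime p : (inr p \in w) = (p \in t).
    by rewrite vw; [rewrite inE in_pair_val | apply/mapP => -[]].
  (* The intermediate state is the part of [w] on [V']. *)
  exists [set p | inl (inr p) \in w]; split.
    rewrite (_ : pair_val _ _ = inl @^-1: w) //.
    by apply/setP => -[p|p]; rewrite in_pair_val !inE // w_base.
  rewrite (_ : pair_val _ _ = @shift V @^-1: w) //.
  by apply/setP => -[p|p]; rewrite in_pair_val !inE // w_dprime.
case=> u [s1 s2]; apply/sat_fexists_seq.
exists [set x : atom3 V | match x with inl y => y \in pair_val s u
                                     | inr p => p \in t end].
  (* Only at an atom of [V'] can the two valuations differ, and those atoms are in the quantified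
     list. *)
  move=> [[p|p]|p]; rewrite [LHS]in_set [RHS]in_set /= ?in_pair_val //.
  by rewrite (map_f (fun q => inl (primed q))) ?mem_enum.
rewrite /= !sat_rename; apply/andP; split.
  rewrite (_ : _ @^-1: _ = pair_val s u) //.
  by apply/setP => x; rewrite in_set in_set.
rewrite (_ : _ @^-1: _ = pair_val u t) //.
by apply/setP => -[p|p]; rewrite in_set /= in_set !in_pair_val.
Qed.

Theorem theorem12 (V : finType) (pi : program V) (s t : {set V}) :
  step pi s t <-> sat (pair_val s t) (tr pi).
Proof.
(* Both states stay general, since composition uses the hypotheses at an intermediate state. *)
elim: pi s t => [p|p|beta|pi1 IH1 pi2 IH2|pi1 IH1 pi2 IH2|pi1 IH1 pi2 IH2] s t.
- rewrite /= in_pair_val /= sat_bigand; split=> [->|/andP[pt /forall_inP st]].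
    rewrite !inE eqxx orbT; apply/forall_inP => q qp.
    by rewrite sat_same !inE (negbTE qp) orbF.
  (* At [p] the literal on [p'] decides membership in [t]; elsewhere the frame conjunct [same q]
     does. *)
  apply/setP => q; rewrite !inE; case: (eqVneq q p) => [->|/st]; rewrite ?orbT //.
  by rewrite sat_same orbF => /eqP.
- rewrite /= in_pair_val /= sat_bigand; split=> [->|/andP[pt /forall_inP st]].
    rewrite !inE eqxx; apply/forall_inP => q qp.
    by rewrite sat_same !inE qp.
  apply/setP => q; rewrite !inE; case: (eqVneq q p) => [->|/st].
    exact/negbTE.
  by rewrite sat_same => /eqP.
- rewrite /= sat_rename sat_bigand.
  (* Pulling back along [base] keeps only the unprimed part, so the test is read at [s]. *)
  have -> : @base V @^-1: pair_val s t = s.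
    by apply/setP => p; rewrite inE in_pair_val.
  split=> [[<- ->]|/andP[sb /forall_inP st]].
    by apply/forall_inP => p _; rewrite sat_same.
  by split=> //; apply/setP => p; apply/eqP; rewrite -sat_same st.
- split=> [[/IH1 s1|/IH2 s2]|/orP[/IH1|/IH2]].
  + by rewrite /= s1.
  + by rewrite /= s2 orbT.
  + by left.
  + by right.
- split=> [[u [/IH1 s1 /IH2 s2]]|/sat_tr_Seq[u [/IH1 s1 /IH2 s2]]].
    by apply/sat_tr_Seq; exists u.
  by exists u.
- split=> [[/IH1 s1 /IH2 s2]|/andP[/IH1 s1 /IH2 s2]] //.
  by rewrite /= s1.
Qed.
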